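(* Let $\Delta\ge3$ be an integer. If $G$ is a finite simple $3$-degenerate graph with maximum degree $\Delta(G)\le\Delta$ and $G$ contains no copy of $K_{3,\Delta}$, then $q_B(G)\le3\Delta-2$.
   Context: A $B$-coloring of a graph $G$ is a proper edge-coloring (incident edges receive distinct colors) in which the edges of every $4$-cycle receive four distinct colors; $q_B(G)$ is the minimum number of colors in a $B$-coloring of $G$. A graph is $d$-degenerate if every nonempty subgraph has a vertex of degree at most $d$ (in that subgraph). ''Contains a copy of $K_{a,b}$'' means contains a subgraph, not necessarily induced, isomorphic to the complete bipartite graph $K_{a,b}$. $\Delta(G)$ denotes the maximum degree of $G$. *)

(* Defs.v *)
From HB Require Import structures.
From mathcomp Require Import all_boot.

Set Implicit Arguments.
Unset Strict Implicit.
Unset Printing Implicit Defensive.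

Record sgraph := SGraph {
  vertex :> finType;
  adj : rel vertex;
  adj_sym : symmetric adj;
  adj_irr : irreflexive adj }.

Definition max_degree (G : sgraph) : nat :=
  \max_(x : G) #|[set y | adj x y]|.

(* A subgraph of [G] is a vertex set [S] with a symmetric relation [f]
   contained in the adjacency of [G] and supported on [S]; it need not be
   induced, and its being nonempty means that [S] is nonempty. *)
Definition degenerate (d : nat) (G : sgraph) : Prop :=
  forall (S : {set G}) (f : rel G),
    symmetric f -> subrel f (@adj G) -> (forall x y, f x y -> x \in S) ->
    S != set0 ->
    exists2 x, x \in S & #|[set y | f x y]| <= d.

Definition contains_copy (H G : sgraph) : Prop :=
  exists2 h : H -> G, injective h & forall x y, adj x y -> adj (h x) (h y).

Definition Kab_adj (a b : nat) : rel ('I_a + 'I_b) :=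
  fun u v => match u, v with
             | inl _, inr _ | inr _, inl _ => true
             | _, _ => false
             end.

Lemma Kab_sym a b : symmetric (@Kab_adj a b).
Proof. by case=> ? []. Qed.

Lemma Kab_irr a b : irreflexive (@Kab_adj a b).
Proof. by case. Qed.

Definition Kab (a b : nat) : sgraph := SGraph (@Kab_sym a b) (@Kab_irr a b).

Definition edges (G : sgraph) : {set {set G}} :=
  [set E | [exists x : G, exists y : G, adj x y && (E == [set x; y])]].

(* Colors are given to edges only, so that an edgeless graph needs none. *)
Definition edge (G : sgraph) : finType := {E : {set G} | E \in edges G}.

Definition proper_coloring (G : sgraph) (C : eqType) (c : edge G -> C) : bool :=
  [forall E : edge G, forall F : edge G,
    (E != F) && (val E :&: val F != set0) ==> (c E != c F)].

(* The 4-cycle is x y z w, with edges E1 = xy, E2 = yz, E3 = zw, E4 = wx. *)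
Definition rainbow_C4 (G : sgraph) (C : eqType) (c : edge G -> C) : bool :=
  [forall x : G, forall y : G, forall z : G, forall w : G,
   forall E1 : edge G, forall E2 : edge G,
   forall E3 : edge G, forall E4 : edge G,
    [&& uniq [:: x; y; z; w],
        val E1 == [set x; y], val E2 == [set y; z],
        val E3 == [set z; w] & val E4 == [set w; x]]
    ==> uniq [:: c E1; c E2; c E3; c E4]].

Definition B_coloring (G : sgraph) (C : eqType) (c : edge G -> C) : bool :=
  proper_coloring c && rainbow_C4 c.

Definition B_colorable (G : sgraph) (k : nat) : bool :=
  [exists c : {ffun edge G -> 'I_k}, B_coloring c].

Lemma B_colorable_ex (G : sgraph) : exists k, B_colorable G k.
Proof.
have neq2 (a b u v : G) : a != u -> a != v -> [set a; b] != [set u; v].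
  move=> au av; apply: contraNneq au => eqS.
  by have := set21 a b; rewrite eqS in_set2 (negPf av) orbF.
exists #|edge G|; apply/existsP; exists [ffun E => enum_rank E].
apply/andP; split.
  apply/forallP => E; apply/forallP => F; apply/implyP => /andP[neqEF _].
  by rewrite !ffunE (inj_eq enum_rank_inj).
apply/forallP => x; apply/forallP => y; apply/forallP => z.
apply/forallP => w; do 4![apply/forallP => ?].
apply/implyP => /and5P[+ /eqP v1 /eqP v2 /eqP v3 /eqP v4].
rewrite /= !ffunE !inE !negb_or !(inj_eq enum_rank_inj) -!(inj_eq val_inj).
rewrite v1 v2 v3 v4 !andbT.
case/and3P=> /and3P[xy xz xw] /andP[yz yw] zw.
have xy_wx : [set x; y] != [set w; x] by rewrite setUC neq2 // eq_sym.
by rewrite xy_wx !neq2 // eq_sym.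
Qed.

Definition qB (G : sgraph) : nat := ex_minn (B_colorable_ex G).

(* Main.v *)
(* Two edges must get distinct colors exactly when they are incident or opposite
   in a 4-cycle.  Delete a vertex v of degree at most 3, color the rest by
   induction, and color the edges at v greedily.  An edge vu sees at most
   Delta - 1 other edges at u, and for each other neighbor w of v at most
   #|N(u) :&: N(w) :\ v| <= Delta - 1 edges wz opposite to it.  If v has three
   neighbors, two of these three codegrees equal to Delta - 1 would make all
   three neighborhoods coincide, giving a K_{3,Delta}; so some neighbor u1 has
   codegree at most Delta - 2 with both others u2, u3, and the order vu3, vu2,
   vu1 leaves at most 3 Delta - 3 forbidden colors at each step. *)

Require Import Defs.
From mathcomp Require Import all_boot.
From mathcomp Require Import zify.

Set Implicit Arguments.
Unset Strict Implicit.
Unset Printing Implicit Defensive.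

Definition neighbors (G : sgraph) (x : G) : {set G} := [set y | adj x y].

(** For distinct neighbors [x], [y] of [v], this counts the 4-cycles [v x z y], hence the edges at
    [y] opposite to [vx]. *)
Definition codegree_off (G : sgraph) (v x y : G) : nat :=
  #|(neighbors x :&: neighbors y) :\ v|.

(* A B-coloring of the subgraph induced by S, as a function on ordered pairs
   whose values off the edges are irrelevant. *)
Record partial_B_coloring (G : sgraph) (C : eqType) (S : {set G})
    (c : G -> G -> C) : Prop := PartialBColoring {
  pBc_sym : forall x y, c x y = c y x;
  pBc_proper : forall x y z, x \in S -> y \in S -> z \in S ->
    adj x y -> adj x z -> y != z -> c x y != c x z;
  pBc_opposite : forall x y z w, x \in S -> y \in S -> z \in S -> w \in S ->
    adj x y -> adj y z -> adj z w -> adj w x -> x != z -> y != w ->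
    c x y != c z w }.

(** * Unordered pairs and greedy list coloring *)

Lemma set2_inj (T : finType) (a b x y : T) :
  [set a; b] = [set x; y] -> (a = x /\ b = y) \/ (a = y /\ b = x).
Proof.
move=> e.
have := set21 a b; rewrite e => /set2P a_xy.
have := set22 a b; rewrite e => /set2P b_xy.
have := set21 x y; rewrite -e => /set2P x_ab.
have := set22 x y; rewrite -e => /set2P y_ab.
by case: a_xy b_xy x_ab y_ab => -> [] -> [] ? [] ?; auto.
Qed.

(** The list is colored from its end: when [x] gets its color, exactly the entries of [q] already
    have theirs. The head is thus colored last and faces the most used colors. *)
Lemma greedy_list_coloring (T : eqType) (C : finType) (x0 : C)
    (F : T -> {set C}) (s : seq T) :
  uniq s ->
  (forall p x q, s = p ++ x :: q -> #|F x| + size q < #|C|) ->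
  exists g : T -> C,
    (forall x, x \in s -> g x \notin F x) /\ {in s &, injective g}.
Proof.
elim: s => [|u s IH] /=; first by move=> _ _; exists (fun=> x0).
case/andP=> us uniq_s small.
have [|g [gF g_inj]] := IH uniq_s.
  by move=> p x q es; apply: (small (u :: p)); rewrite es.
have /subsetPn[a _] : ~~ (setT \subset F u :|: [set x in map g s]).
  apply/negP=> /subset_leq_card; rewrite cardsT leqNgt => /negP[].
  apply: leq_ltn_trans (small [::] u s erefl).
  apply: leq_trans (leq_card_setU _ _) _; rewrite leq_add2l cardsE.
  by rewrite -(size_map g); apply: card_size.
rewrite !inE => /norP[aF /mapP ag].
exists (fun x => if x == u then a else g x); split=> [x|x y].
  by rewrite inE; case: eqP => [->//|_] /=; apply: gF.
rewrite !inE; case: eqP => [->|_] /=; case: eqP => [->|_] //=.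
- by move=> _ ys e; case: ag; exists y.
- by move=> xs _ e; case: ag; exists x.
exact: g_inj.
Qed.

(** * Codegrees at a vertex and copies of $K_{3,\Delta}$ *)

Section Graph.

Variables (G : sgraph) (Delta : nat).
Hypothesis max_degG : max_degree G <= Delta.

Lemma card_neighbors (x : G) : #|neighbors x| <= Delta.
Proof.
by apply: leq_trans max_degG; apply: (leq_bigmax (F := fun x : G => #|neighbors x|)).
Qed.

Lemma card_neighbors_off (v u : G) : adj v u -> #|neighbors u :\ v| <= Delta.-1.
Proof.
move=> vu; have := card_neighbors u.
by rewrite (cardsD1 v) inE adj_sym vu; lia.
Qed.

Lemma codegree_offC (v u w : G) : codegree_off v u w = codegree_off v w u.
Proof. by rewrite /codegree_off setIC. Qed.

Lemma codegree_off_le (v u w : G) : adj v u -> codegree_off v u w <= Delta.-1.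
Proof.
move=> vu; apply: leq_trans (card_neighbors_off vu).
by apply/subset_leq_card/setSD/subsetIl.
Qed.

(** Adding back [v] gives [Delta] common neighbors. Neither neighborhood can be larger, so both
    equal the intersection. *)
Lemma codegree_off_full (v u w : G) : 0 < Delta -> adj v u -> adj v w ->
  Delta.-1 <= codegree_off v u w ->
  neighbors u = neighbors w /\ #|neighbors u| = Delta.
Proof.
move=> D0 vu vw full.
have cardI : Delta <= #|neighbors u :&: neighbors w|.
  rewrite (cardsD1 v) !inE adj_sym vu adj_sym vw /=.
  by move: full; rewrite /codegree_off; lia.
have eqI (x y : G) : Delta <= #|neighbors x :&: neighbors y| ->
    neighbors x :&: neighbors y = neighbors x.
  move=> le_I; apply/eqP; rewrite eqEcard subsetIl /=.
  exact: leq_trans (card_neighbors x) le_I.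
have eu := eqI _ _ cardI.
have ew : neighbors w :&: neighbors u = neighbors w by apply: eqI; rewrite setIC.
split; first by rewrite -[LHS]eu -[RHS]ew setIC.
by apply/eqP; rewrite eqn_leq card_neighbors -{1}eu.
Qed.

Lemma same_neighbors_K3 (u1 u2 u3 : G) : uniq [:: u1; u2; u3] ->
  neighbors u2 = neighbors u1 -> neighbors u3 = neighbors u1 ->
  #|neighbors u1| = Delta -> contains_copy (Kab 3 Delta) G.
Proof.
move=> uniq_u e2 e3 cardN.
pose left (i : 'I_3) := nth u1 [:: u1; u2; u3] i.
pose right (j : 'I_Delta) := nth u1 (enum (neighbors u1)) j.
have size_right : size (enum (neighbors u1)) = Delta by rewrite -cardE.
have adjLR i j : adj (left i) (right j).
  have rj : right j \in neighbors u1 by rewrite -mem_enum mem_nth // size_right.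
  suff : right j \in neighbors (left i) by rewrite inE.
  by rewrite /left; case: i => [[|[|[|//]]]] //= _; rewrite ?e2 ?e3.
have neqLR i j : left i <> right j.
  by move=> e; have := adjLR i j; rewrite e adj_irr.
exists (fun u => match u with inl i => left i | inr j => right j end).
  move=> [i|j] [i'|j'] //= e.
  - congr inl; apply/val_inj/eqP.
    by rewrite -(nth_uniq u1 _ _ uniq_u) ?ltn_ord //; apply/eqP.
  - by case: (neqLR _ _ e).
  - by case: (neqLR _ _ (esym e)).
  congr inr; apply/val_inj/eqP.
  by rewrite -(nth_uniq u1 _ _ (enum_uniq (neighbors u1))) ?size_right ?ltn_ord //; apply/eqP.
by move=> [i|j] [i'|j'] //= _; rewrite adj_sym.
Qed.

Hypothesis Delta_gt2 : 3 <= Delta.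
Hypothesis noK : ~ contains_copy (Kab 3 Delta) G.

(** Any two of the three pairs share a vertex, so two pairs of codegree above [Delta - 2] would
    force all three neighborhoods to coincide. At most one pair is large, and [u1] is taken outside
    it. *)
Lemma exists_small_codegrees (v : G) (A : {set G}) :
  #|A| = 3 -> {in A, forall u, adj v u} ->
  exists u1 u2 u3, [/\ A =i [:: u1; u2; u3], uniq [:: u1; u2; u3],
    codegree_off v u1 u2 <= Delta - 2 & codegree_off v u1 u3 <= Delta - 2].
Proof.
move=> card_A vA.
have [a [b [c [eA uA]]]] :
    exists a b c, A =i [:: a; b; c] /\ uniq [:: a; b; c].
  have := mem_enum A; have := enum_uniq A; move: card_A; rewrite cardE.
  case: (enum A) => [|a [|b [|c [|//]]]] //= _ uA eA.
  by exists a, b, c; split=> // x; rewrite -eA.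
have [va vb vc] : [/\ adj v a, adj v b & adj v c].
  by split; apply: vA; rewrite eA !inE eqxx ?orbT.
have two_full x y z : uniq [:: x; y; z] -> adj v x -> adj v y -> adj v z ->
    Delta - 2 < codegree_off v x y -> codegree_off v x z <= Delta - 2.
  move=> uxyz vx vy vz fxy; rewrite leqNgt; apply/negP=> fxz; apply: noK.
  have [||exy cx] := @codegree_off_full v x y _ vx vy; [lia | lia |].
  have [||exz _] := @codegree_off_full v x z _ vx vz; [lia | lia |].
  exact: same_neighbors_K3 uxyz (esym exy) (esym exz) cx.
have [ab ac bc] : [/\ a != b, a != c & b != c].
  by move: uA; rewrite /= !inE negb_or andbT => /andP[/andP[]].
have uniq3 (x y z : G) : x != y -> x != z -> y != z -> uniq [:: x; y; z].
  by move=> xy xz yz; rewrite /= !inE negb_or xy xz yz.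
(* [u1] is [c] if the pair [a], [b] is large, [b] if the pair [a], [c] is large, and [a]
   otherwise. *)
have [cab|cab] := leqP (codegree_off v a b) (Delta - 2); last first.
  exists c, a, b; split.
  - by move=> x; rewrite eA !inE; case: (x == a); case: (x == b); case: (x == c).
  - by apply: uniq3; rewrite // eq_sym.
  - by rewrite codegree_offC; apply: (two_full a b c).
  rewrite codegree_offC; apply: (two_full b a c) => //; last by rewrite codegree_offC.
  by apply: uniq3; rewrite // eq_sym.
have [cac|cac] := leqP (codegree_off v a c) (Delta - 2).
  by exists a, b, c.
exists b, a, c; split.
- by move=> x; rewrite eA !inE; case: (x == a); case: (x == b); case: (x == c).
- by apply: uniq3; rewrite // eq_sym.
- by rewrite codegree_offC.
rewrite codegree_offC; apply: (two_full c a b) => //; last by rewrite codegree_offC.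
by apply: uniq3; rewrite // eq_sym.
Qed.

(** * Coloring the edges at a deleted vertex *)

Section Extension.

Variables (C : finType) (c : G -> G -> C) (v : G) (A : {set G}).
Hypothesis vA : {in A, forall u, adj v u}.

(** Colors barred from [vu]: those of the other edges at [u], then those of the edges [wz] opposite
    to [vu] in a 4-cycle [v u z w]. Here [z] ranges over the whole graph, which the count can
    afford. *)
Definition forbidden (u : G) : {set C} :=
  [set c u z | z in neighbors u :\ v] :|:
  \bigcup_(w in A :\ u) [set c w z | z in (neighbors u :&: neighbors w) :\ v].

Lemma card_forbidden (s : seq G) (u : G) : u \in A -> A :\ u =i s -> uniq s ->
  #|forbidden u| <= Delta.-1 + \sum_(w <- s) codegree_off v u w.
Proof.
move=> uA es uniq_s; apply: leq_trans (leq_card_setU _ _) _.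
apply: leq_add.
  by apply: leq_trans (leq_imset_card _ _) _; apply/card_neighbors_off/vA.
rewrite (big_uniq _ uniq_s) /=.
rewrite -(eq_bigl _ _ es).
elim/big_ind2: _ => [|B m D n Bm Dn|w _]; first by rewrite cards0.
  by apply: leq_trans (leq_card_setU _ _) _; apply: leq_add.
exact: leq_imset_card.
Qed.

Lemma color_star (x0 : C) : #|C| = 3 * Delta - 2 -> #|A| <= 3 ->
  exists g : G -> C,
    {in A, forall u, g u \notin forbidden u} /\ {in A &, injective g}.
Proof.
move=> cardC; rewrite leq_eqVlt => /orP[/eqP card_A | card_A].
  have [u1 [u2 [u3 [eA uA c12 c13]]]] := exists_small_codegrees card_A vA.
  have [A1 A2 A3] : [/\ u1 \in A, u2 \in A & u3 \in A].
    by rewrite !eA !inE !eqxx ?orbT.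
  have [n12 n13 n23] : [/\ u1 != u2, u1 != u3 & u2 != u3].
    by move: uA; rewrite /= !inE negb_or andbT => /andP[/andP[]].
  have F1 : #|forbidden u1| <= Delta.-1 + \sum_(w <- [:: u2; u3]) codegree_off v u1 w.
    apply: card_forbidden; rewrite //= ?inE ?n23 // => x; rewrite !inE eA !inE.
    by case: (eqVneq x u1) => [->|]; rewrite ?(negPf n12) ?(negPf n13).
  have F2 : #|forbidden u2| <= Delta.-1 + \sum_(w <- [:: u1; u3]) codegree_off v u2 w.
    apply: card_forbidden; rewrite //= ?inE ?n13 // => x; rewrite !inE eA !inE.
    by case: (eqVneq x u2) => [->|]; rewrite ?(negPf n23) ?[u2 == u1]eq_sym ?(negPf n12).
  have F3 : #|forbidden u3| <= Delta.-1 + \sum_(w <- [:: u1; u2]) codegree_off v u3 w.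
    apply: card_forbidden; rewrite //= ?inE ?n12 // => x; rewrite !inE eA !inE.
    case: (eqVneq x u3) => [->|]; rewrite ?orbF //.
    by rewrite !(eq_sym u3) (negPf n13) (negPf n23).
  rewrite !big_cons !big_nil in F1 F2 F3.
  have c23 := codegree_off_le u3 (vA A2).
  have c21 : codegree_off v u2 u1 <= Delta - 2 by rewrite codegree_offC.
  have c31 : codegree_off v u3 u1 <= Delta - 2 by rewrite codegree_offC.
  have c32 := codegree_off_le u2 (vA A3).
  (* Colors to avoid, including those just used at [v]: at most [3 * Delta - 4] for [u3], then
     [3 * Delta - 3] for [u2]. For [u1], both codegrees are small, so
     [(Delta - 1) + 2 * (Delta - 2) + 2] again gives [3 * Delta - 3]. *)
  have [//||g [gF g_inj]] := @greedy_list_coloring _ _ x0 forbidden [:: u1; u2; u3].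
    move=> [|? [|? [|? [|//]]]] x q //= [].
    - by move=> <- <-; rewrite cardC /=; lia.
    - by move=> _ <- <-; rewrite cardC /=; lia.
    by move=> _ _ <- <-; rewrite cardC /=; lia.
  by exists g; split=> [u|u w]; rewrite !eA; [apply: gF | apply: g_inj].
(* With at most two neighbors any order works: at most [2 * (Delta - 1) + 1] colors are excluded. *)
have [||g [gF g_inj]] := @greedy_list_coloring _ _ x0 forbidden (enum A).
- exact: enum_uniq.
- move=> p x q eA.
  have size_A : size p + size q < 2 by move: card_A; rewrite cardE eA size_cat /= addnS ltnS.
  have xA : x \in A by rewrite -mem_enum eA mem_cat mem_head orbT.
  have uniq_A := enum_uniq A; rewrite eA cat_uniq /= in uniq_A.
  have memA : A :\ x =i p ++ q.
    move=> y; rewrite !inE -mem_enum eA !mem_cat inE.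
    case: (eqVneq y x) => [->|//] /=; case/and3P: uniq_A => _ /norP[xp _] /andP[xq _].
    by rewrite (negPf xp) (negPf xq).
  have uniq_pq : uniq (p ++ q).
    by rewrite cat_uniq; case/and3P: uniq_A => -> /norP[_ ->] /andP[_ ->].
  have Fx := card_forbidden xA memA uniq_pq.
  have size_pq : size (p ++ q) < 2 by rewrite size_cat.
  have sum_le : \sum_(w <- p ++ q) codegree_off v x w <= Delta.-1.
    case: (p ++ q) size_pq => [|w [|//]] _; first by rewrite big_nil.
    by rewrite big_seq1; apply/codegree_off_le/vA.
  have size_q : size q <= 1 by move: size_A; case: (size p); lia.
  rewrite cardC; apply: (@leq_ltn_trans (Delta.-1 + Delta.-1 + 1)); last by lia.
  by apply: leq_add size_q; apply: leq_trans Fx _; rewrite leq_add2l.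
by exists g; split=> [u uA|u w uA wA]; [apply: gF | apply: g_inj]; rewrite mem_enum.
Qed.

End Extension.

(** The edge [vu] receives [g u]. Injectivity of [g] separates the edges at [v], and the two parts
    of [forbidden] handle incidences and opposite edges away from [v]. *)
Lemma extend_coloring (C : finType) (S : {set G}) (v : G) (c : G -> G -> C)
    (g : G -> C) (A := [set u in S | adj v u]) :
  partial_B_coloring (S :\ v) c ->
  {in A, forall u, g u \notin forbidden c v A u} -> {in A &, injective g} ->
  partial_B_coloring S
    (fun x y => if x == v then g y else if y == v then g x else c x y).
Proof.
move=> [c_sym c_proper c_opp] gF g_inj.
have inA u : u \in S -> adj v u -> u \in A by move=> uS vu; rewrite inE uS.
have g_inc u z : u \in S -> adj v u -> adj u z -> z != v -> g u != c u z.
  move=> uS vu uz zv; apply: contraNneq (gF u (inA u uS vu)) => ->.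
  by rewrite inE imset_f // !inE zv.
have g_opp u w z : u \in S -> adj v u -> w \in S -> adj v w -> u != w ->
    adj u z -> adj w z -> z != v -> g u != c w z.
  move=> uS vu wS vw uw uz wz zv; apply: contraNneq (gF u (inA u uS vu)) => ->.
  rewrite inE; apply/orP; right; apply/bigcupP; exists w.
    by rewrite !inE eq_sym uw wS.
  by rewrite imset_f // !inE zv uz.
have adj_neq (x y : G) : adj x y -> x != y.
  by apply: contraTneq => ->; rewrite adj_irr.
split=> [x y|x y z xS yS zS xy xz yz|x y z w xS yS zS wS xy yz zw wx nxz nyw].
- by case: (eqVneq x v) => [->|_]; case: (eqVneq y v) => [e|_] //; rewrite e.
- case: (eqVneq x v) => [ex|xv].
    by subst x; apply: contra_neq yz; apply: g_inj; apply: inA.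
  case: (eqVneq y v) => [ey|yv].
    subst y; rewrite eq_sym in yz; rewrite (negPf yz).
    by apply: g_inc; rewrite // adj_sym.
  case: (eqVneq z v) => [ez|zv].
    by subst z; rewrite eq_sym; apply: g_inc; rewrite // adj_sym.
  by apply: c_proper; rewrite // !inE ?xv ?yv ?zv.
(* Whichever vertex of the 4-cycle is [v], exactly one of the two opposite edges contains it, so
   symmetry reduces each case to [g_opp]. *)
have [[[nxy nyz] nzw] nwx] := (adj_neq _ _ xy, adj_neq _ _ yz, adj_neq _ _ zw, adj_neq _ _ wx).
case: (eqVneq x v) => [ex|xv].
  subst x; rewrite (eq_sym z) (negPf nxz) (negPf nwx) c_sym.
  by apply: g_opp => //; rewrite 1?adj_sym // 1?eq_sym.
case: (eqVneq y v) => [ey|yv].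
  subst y; rewrite (eq_sym z) (negPf nyz) (eq_sym w) (negPf nyw).
  by apply: g_opp => //; rewrite 1?adj_sym // 1?eq_sym.
case: (eqVneq z v) => [ez|zv].
  subst z; rewrite eq_sym c_sym.
  by apply: g_opp => //; rewrite 1?adj_sym // 1?eq_sym.
case: (eqVneq w v) => [ew|wv].
  subst w; rewrite eq_sym.
  by apply: g_opp => //; rewrite 1?adj_sym // 1?eq_sym.
by apply: c_opp; rewrite // !inE ?xv ?yv ?zv ?wv.
Qed.

Lemma partial_B_coloring_exists (C : finType) (x0 : C) (S : {set G}) :
  degenerate 3 G -> #|C| = 3 * Delta - 2 ->
  exists c : G -> G -> C, partial_B_coloring S c.
Proof.
move=> degG cardC.
elim: {S}#|S| {-2}S (erefl #|S|) => [|n IH] S cardS.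
  move/eqP: cardS; rewrite cards_eq0 => /eqP->.
  by exists (fun _ _ => x0); split=> // x y z; rewrite inE.
(* Degeneracy is applied to the subgraph induced by [S], so [degv] bounds only the neighbors of [v]
   inside [S]. *)
have [||||v vS degv] :=
    degG S (fun x y => [&& adj x y, x \in S & y \in S]).
- by move=> x y; rewrite adj_sym [(x \in S) && _]andbC.
- by move=> x y /andP[].
- by move=> x y /and3P[].
- by rewrite -card_gt0 cardS.
have [|c c_B] := IH (S :\ v).
  by move: cardS; rewrite (cardsD1 v) vS => -[].
pose A := [set u in S | adj v u].
have vA : {in A, forall u, adj v u} by move=> u; rewrite inE => /andP[].
have cardA : #|A| <= 3.
  by apply: leq_trans degv; apply/subset_leq_card/subsetP=> u; rewrite !inE vS andbC.
have [g [gF g_inj]] := color_star c vA x0 cardC cardA.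
by eexists; apply: extend_coloring c_B gF g_inj.
Qed.

End Graph.

(** * From functions on ordered pairs to colorings of edges *)

Lemma B_colorable_of_partial (G : sgraph) (k : nat) (c : G -> G -> 'I_k)
    (x0 : 'I_k) :
  partial_B_coloring setT c -> B_colorable G k.
Proof.
move=> [c_sym c_proper c_opp].
(* An arbitrary ordering of the two ends is picked; symmetry of [c] makes the choice harmless. The
   default [x0] is never reached on an edge. *)
pose col (E : edge G) : 'I_k :=
  if [pick p : G * G | val E == [set p.1; p.2]] is Some p then c p.1 p.2 else x0.
have colE (E : edge G) x y : val E = [set x; y] -> col E = c x y.
  move=> eE; rewrite /col; case: pickP => [[a b] /= /eqP|/(_ (x, y))].
    by rewrite eE => /set2_inj[] [-> ->].
  by rewrite eE eqxx.
have edgeP (E : edge G) : exists x y, adj x y /\ val E = [set x; y].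
  have := valP E; rewrite inE => /existsP[x /existsP[y /andP[xy /eqP eE]]].
  by exists x, y.
have adjE (E : edge G) x y : val E = [set x; y] -> adj x y.
  have [a [b [ab ->]]] := edgeP E.
  by case/set2_inj=> [] [<- <-] //; rewrite adj_sym.
have edge_at (E : edge G) x : x \in val E -> exists y, adj x y /\ val E = [set x; y].
  have [a [b [ab eE]]] := edgeP E; rewrite eE => /set2P[->|->].
    by exists b.
  by exists a; rewrite adj_sym setUC.
have col_incident (E F : edge G) x :
    E != F -> x \in val E -> x \in val F -> col E != col F.
  move=> nEF /edge_at[y [xy eE]] /edge_at[z [xz eF]].
  rewrite (colE _ _ _ eE) (colE _ _ _ eF) c_proper ?inE //.
  by apply: contra_neq nEF => yz; apply: val_inj; rewrite eE eF yz.
apply/existsP; exists [ffun E => col E]; apply/andP; split.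
  apply/forallP=> E; apply/forallP=> F; apply/implyP=> /andP[nEF /set0Pn[x]].
  by rewrite !ffunE inE => /andP[xE xF]; apply: col_incident nEF xE xF.
apply/forallP => x; apply/forallP => y; apply/forallP => z.
apply/forallP => w; apply/forallP => E1; apply/forallP => E2.
apply/forallP => E3; apply/forallP => E4.
apply/implyP => /and5P[uxyzw /eqP e1 /eqP e2 /eqP e3 /eqP e4].
move: uxyzw; rewrite /= !ffunE !inE !negb_or !andbT.
case/and3P=> /and3P[xy xz xw] /andP[yz yw] zw.
rewrite (colE _ _ _ e1) (colE _ _ _ e2) (colE _ _ _ e3) (colE _ _ _ e4).
move: (adjE _ _ _ e1) (adjE _ _ _ e2) (adjE _ _ _ e3) (adjE _ _ _ e4).
move=> a1 a2 a3 a4.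
have inc a b d : adj a b -> adj b d -> a != d -> c a b != c b d.
  by move=> ab bd nad; rewrite (c_sym a) c_proper ?inE // adj_sym.
have wy : w != y by rewrite eq_sym.
have zx : z != x by rewrite eq_sym.
(* Of the six pairs of edges in the cycle, two are opposite ([c_opp]) and four are incident
   ([inc]). *)
rewrite (c_opp x y z w) ?inE // (c_opp y z w x) ?inE //.
rewrite (inc x y z) // (inc y z w) // (inc z w x) // [c x y == _]eq_sym.
by rewrite (inc w x y).
Qed.

Theorem theorem2p8 (Delta : nat) (G : sgraph) :
  3 <= Delta ->
  degenerate 3 G ->
  max_degree G <= Delta ->
  ~ contains_copy (Kab 3 Delta) G ->
  qB G <= 3 * Delta - 2.
Proof.
move=> D3 degG maxG noK.
(* Positivity supplies a color to serve as the default value. *)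
have k_gt0 : 0 < 3 * Delta - 2 by lia.
have [c c_B] := partial_B_coloring_exists maxG D3 noK (Ordinal k_gt0) setT degG (card_ord _).
rewrite /qB; case: ex_minnP => m _; apply.
exact: B_colorable_of_partial (Ordinal k_gt0) c_B.
Qed.
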